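(* Let $G$ and $H$ be nontrivial graphs with $G$ connected, let $k\in\{2,\ldots,n(G)\cdot n(H)-1\}$, and set $j=\lceil k/n(H)\rceil$ and $\ell=\min\{k,n(G)\}$. If $k\le n(H)$, then $${\rm sgp}_k(G\circ H)\ge \max_{S\in\mathcal{G}_{2,k}}\big\{|\mathcal{I}_S|\,{\rm sjc}_k(H)+|\mathcal{J}_S|\,s\omega_k(H)\big\},$$ and if $n(H)<k<n(G)\cdot n(H)$, then ${\rm sgp}_k(G\circ H)\ge {\rm sgp}_{[j:\ell]}(G)\cdot n(H)$. Moreover, if $k>(n(G)-1)n(H)$, then ${\rm sgp}_k(G\circ H)={\rm sgp}_{[j:\ell]}(G)\cdot n(H)$.
   Context: Graphs are finite and simple; nontrivial means at least two vertices; $n(G)$ is the number of vertices. The lexicographic product $G\circ H$ has vertex set $V(G)\times V(H)$, with $(g,h)$ adjacent to $(g',h')$ iff $gg'\in E(G)$, or $g=g'$ and $hh'\in E(H)$. For nonempty $W\subseteq V(X)$ of a graph $X$, the Steiner distance $d_X(W)$ is the minimum number of edges of a connected subgraph containing $W$ ($\infty$ if none); such a minimum subgraph is a tree, a Steiner $W$-tree. For a positive integer $k$, $A\subseteq V(X)$ is a $k$-Steiner general position set if for every $k$-subset $B\subseteq A$ and every Steiner $B$-tree $T_B$, $V(T_B)\cap A=B$; ${\rm sgp}_k(X)$ is the largest size of such a set. For $a\le b$, a $[a:b]$-Steiner general position set is a set that is a $t$-Steiner general position set for every integer $t$ with $a\le t\le b$; ${\rm sgp}_{[a:b]}(X)$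 is the largest size of such a set, and $\mathcal{G}_{a,b}$ is the family of all $[a:b]$-Steiner general position sets of $G$. For $S\subseteq V(G)$, $\mathcal{I}_S$ is the set of isolated vertices of the induced subgraph $G[S]$ and $\mathcal{J}_S=S\setminus\mathcal{I}_S$. For $k\ge 2$, a $k$-Steiner clique of $H$ is a set $A$ with $H[B]$ connected for every $k$-subset $B\subseteq A$ (sets of size $<k$ qualify trivially), and $s\omega_k(H)$ is the largest size of one. A set $A\subseteq V(H)$ with $|A|\ge k$ is $k$-Steiner join-critical if $d_{H[A]}(B)\ne k$ for every $k$-subset $B\subseteq A$; ${\rm sjc}_k(H)$ is the largest size of such a set. *)

(* Defs.v *)
From HB Require Import structures.
From mathcomp Require Import all_boot.
Set Implicit Arguments.
Unset Strict Implicit.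
Unset Printing Implicit Defensive.

Record sgraph := SGraph {
  vertex :> finType;
  adj : rel vertex;
  adj_sym : symmetric adj;
  adj_irr : irreflexive adj }.

Definition connected (X : sgraph) : bool :=
  [forall x : X, forall y : X, connect (@adj X) x y].

Section Induced.
Variables (X : sgraph) (A : {set X}).
Definition induced_adj : rel {x : X | x \in A} :=
  fun u v => adj (val u) (val v).
Lemma induced_sym : symmetric induced_adj.
Proof. by move=> u v; exact: adj_sym. Qed.
Lemma induced_irr : irreflexive induced_adj.
Proof. by move=> u; exact: adj_irr. Qed.
Definition induced : sgraph := SGraph induced_sym induced_irr.
End Induced.

Section Lexicographic.
Variables G H : sgraph.
Definition lex_adj : rel (G * H) :=
  fun p q => adj p.1 q.1 || (p.1 == q.1) && adj p.2 q.2.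
Lemma lex_sym : symmetric lex_adj.
Proof. by move=> p q; rewrite /lex_adj adj_sym eq_sym (adj_sym p.2). Qed.
Lemma lex_irr : irreflexive lex_adj.
Proof. by move=> p; rewrite /lex_adj !adj_irr andbF. Qed.
Definition lex : sgraph := SGraph lex_sym lex_irr.
End Lexicographic.

Section Steiner.
Variable X : sgraph.

Definition edges : {set {set X}} :=
  [set [set p.1; p.2] | p : X * X & adj p.1 p.2].

(* A candidate subgraph is a pair (vertex set, edge set). *)
Definition is_subgraph (T : {set X} * {set {set X}}) : bool :=
  (T.2 \subset edges) && (cover T.2 \subset T.1).

Definition connected_subgraph (T : {set X} * {set {set X}}) : bool :=
  is_subgraph T &&
  [forall x in T.1, forall y in T.1,
     connect [rel u v | [set u; v] \in T.2] x y].

Definition spans (W : {set X}) : pred ({set X} * {set {set X}}) :=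
  [pred T | connected_subgraph T & W \subset T.1].

(* The value None stands for an infinite distance. *)
Definition steiner_dist (W : {set X}) : option nat :=
  if [pick T | spans W T] is Some T0
  then Some #|([arg min_(T < T0 | spans W T) #|T.2|]).2|
  else None.

(* Acyclicity is not required: it follows from minimality. *)
Definition steiner_tree (W : {set X}) (T : {set X} * {set {set X}}) : bool :=
  spans W T && (steiner_dist W == Some #|T.2|).

Definition steiner_gp (k : nat) (A : {set X}) : bool :=
  [forall B : {set X}, (B \subset A) && (#|B| == k) ==>
     [forall T, steiner_tree B T ==> (T.1 :&: A == B)]].

Definition sgp (k : nat) : nat := \max_(A : {set X} | steiner_gp k A) #|A|.

Definition steiner_gp_itv (a b : nat) (A : {set X}) : bool :=
  [forall t : 'I_b.+1, (a <= t) ==> steiner_gp t A].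

Definition sgp_itv (a b : nat) : nat :=
  \max_(A : {set X} | steiner_gp_itv a b A) #|A|.

Definition steiner_clique (k : nat) (A : {set X}) : bool :=
  [forall B : {set X}, (B \subset A) && (#|B| == k) ==>
     connected (induced B)].

Definition somega (k : nat) : nat :=
  \max_(A : {set X} | steiner_clique k A) #|A|.

Definition isolated : {set X} := [set x : X | [forall y : X, ~~ adj x y]].
End Steiner.

(* The preimage under val views B as a vertex set of the induced subgraph. *)
Definition join_critical (X : sgraph) (k : nat) (A : {set X}) : bool :=
  (k <= #|A|) &&
  [forall B : {set X}, (B \subset A) && (#|B| == k) ==>
     (@steiner_dist (induced A) [set u | val u \in B] != Some k)].

(* For 0 < k <= #|X| any k-set is join-critical, so this is the maximum over a
   nonempty family; for k > #|X| the family is empty and the value is 0. *)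
Definition sjc (X : sgraph) (k : nat) : nat :=
  \max_(A : {set X} | join_critical k A) #|A|.

Definition isoset (X : sgraph) (S : {set X}) : {set X} :=
  [set val u | u in isolated (induced S)].

Definition nonisoset (X : sgraph) (S : {set X}) : {set X} :=
  S :\: isoset S.

(* The ceiling of m / d, for d > 0. *)
Definition ceil_div (m d : nat) : nat := m %/ d + ~~ (d %| m).

(* Main.v *)
(* Up to the choice of a spanning tree, a Steiner W-tree is a connected vertex
   set containing W of minimum cardinality.  Let U be such a set for B in
   G o H, and let P be the projection of B to G.  If P has at least two
   vertices, U must consist of B and one vertex over each g in Q \ P, where
   Q is the vertex set of a Steiner P-tree; so U meets a union of layers over S
   only in B as soon as Q meets S only in P.  If P = {g}, then either B is
   connected, or U is B plus one vertex w; w lies over g, which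
   join-criticality excludes, or over a neighbour of g, which is not in S when
   g is isolated in S. *)
Require Import Defs.
From HB Require Import structures.
From mathcomp Require Import all_boot.
Set Implicit Arguments.
Unset Strict Implicit.
Unset Printing Implicit Defensive.

(** * Cuts and growing trees *)

(* Connectedness is expressed through cuts, so that it can be transferred between
   G, H and G o H without manipulating paths. *)
Definition cut_connected (T : finType) (e : rel T) (U : {set T}) : Prop :=
  forall (W : {set T}) x y, x \in U -> y \in U -> x \in W -> y \notin W ->
  exists a b, [/\ a \in U, b \in U, a \in W, b \notin W & e a b].

Lemma eq_cut_connected (T : finType) (e e' : rel T) (U : {set T}) :
  e =2 e' -> cut_connected e U -> cut_connected e' U.
Proof.
move=> ee' cU W x y xU yU xW yW.
have [a [b [aU bU aW bW eab]]] := cU W x y xU yU xW yW.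
by exists a, b; split; rewrite // -ee'.
Qed.

(** A path from [x] to [y] starts inside [W] and ends outside it, so one of its edges crosses the
    cut; [eU] keeps the path in [U]. *)
Lemma connect_cut_connected (T : finType) (e : rel T) (U : {set T}) :
  (forall a b, e a b -> (a \in U) && (b \in U)) ->
  {in U &, forall x y, connect e x y} -> cut_connected e U.
Proof.
move=> eU cU W x y xU yU xW yW.
have /connectP[p] := cU x y xU yU; elim: p x xU xW => [|z p IHp] x xU xW /=.
  by move=> _ yx; rewrite yx xW in yW.
case/andP=> exz pz ylast; have /andP[_ zU] := eU _ _ exz.
have [zW|zW] := boolP (z \in W); first exact: IHp zU zW pz ylast.
by exists x, z; split.
Qed.

Definition edge_rel (T : finType) (E : {set {set T}}) : rel T :=
  [rel u v | [set u; v] \in E].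

Lemma edge_rel_sym (T : finType) (E : {set {set T}}) : symmetric (edge_rel E).
Proof. by move=> u v; rewrite /edge_rel /= setUC. Qed.

(* A tree is grown from one vertex by repeatedly adding an edge that leaves the
   current vertex set W. *)
Lemma partial_tree (T : finType) (E : {set {set T}}) (U : {set T}) n :
  cut_connected (edge_rel E) U -> n < #|U| ->
  exists (W : {set T}) (F : {set {set T}}),
    [/\ W \subset U, #|W| = n.+1, F \subset E, #|F| = n &
    cover F \subset W /\ {in W &, forall x y, connect (edge_rel F) x y}].
Proof.
move=> cU; elim: n => [|n IHn] ltnU.
  have [x xU] := card_gt0P ltnU.
  exists [set x], set0; split; rewrite ?sub1set ?cards1 ?sub0set ?cards0 //.
  split; first by rewrite /cover big_set0 sub0set.
  by move=> u v /set1P-> /set1P->.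
have [W [F [sWU cardW sFE cardF [covF cF]]]] := IHn (ltnW ltnU).
have [x xW] : exists x, x \in W by apply/card_gt0P; rewrite cardW.
have /subsetPn[y yU yW] : ~~ (U \subset W).
  by apply/negP=> /subset_leq_card; rewrite cardW leqNgt ltnU.
have [a [b [aU bU aW bW Eab]]] := cU W x y (subsetP sWU x xW) yU xW yW.
have FabN : [set a; b] \notin F.
  apply: contra bW => Fab; apply: (subsetP covF).
  by apply/bigcupP; exists [set a; b]; rewrite ?set22.
exists (b |: W), ([set a; b] |: F); split.
- by rewrite subUset sub1set bU sWU.
- by rewrite cardsU1 bW cardW.
- by rewrite subUset sub1set sFE andbT.
- by rewrite cardsU1 FabN cardF.
split.
  apply/bigcupsP=> e /setU1P[->|Fe].
    by rewrite subUset !sub1set !inE eqxx aW orbT.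
  by rewrite subsetU // (subset_trans _ covF) ?orbT // bigcup_sup.
have symF := sym_connect_sym (edge_rel_sym ([set a; b] |: F)).
have to_a u : u \in b |: W -> connect (edge_rel ([set a; b] |: F)) u a.
  case/setU1P=> [->|uW].
    by rewrite symF connect1 // /edge_rel /= setU11.
  apply: connect_sub (cF u a uW aW) => c d Fcd.
  by apply: connect1; rewrite /edge_rel /= in Fcd *; rewrite setU1r.
by move=> u v /to_a ua /to_a va; apply: connect_trans ua _; rewrite symF.
Qed.

(** * Steiner trees as minimum connected vertex sets *)

Section VertexSets.
Variable X : sgraph.
Implicit Types (U W : {set X}) (T : {set X} * {set {set X}}).

Definition connected_set U := cut_connected (@adj X) U.

Definition min_connected W U : Prop :=
  [/\ connected_set U, W \subset U &
      forall U', connected_set U' -> W \subset U' -> #|U| <= #|U'|].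

Lemma edge_rel_edges : edge_rel (edges X) =2 @adj X.
Proof.
move=> u v; apply/imsetP/idP => [[[a b]]|uv]; last by exists (u, v); rewrite ?inE.
rewrite inE /= => ab /setP uv_ab.
have := uv_ab b; have := uv_ab a.
rewrite !inE !eqxx !orbT => /orP[]/eqP aE /orP[]/eqP bE; move: ab; rewrite aE bE.
- by rewrite adj_irr.
- by [].
- by rewrite adj_sym.
- by rewrite adj_irr.
Qed.

Lemma connected_subgraph_cut T :
  connected_subgraph T -> cut_connected (edge_rel T.2) T.1.
Proof.
case/andP=> /andP[_ covT] /forall_inP cT; apply: connect_cut_connected.
  move=> a b Tab; rewrite -2!sub1set -subUset; apply: subset_trans covT.
  exact: (bigcup_sup [set a; b]).
by move=> x y xT; move/forall_inP: (cT x xT); apply.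
Qed.

Lemma connected_subgraph_set T : connected_subgraph T -> connected_set T.1.
Proof.
move=> cT; have /andP[/andP[/subsetP sT _] _] := cT.
move=> W x y xT yT xW yW.
have [a [b [aT bT aW bW Tab]]] := connected_subgraph_cut cT xT yT xW yW.
by exists a, b; split; rewrite // -edge_rel_edges; apply: sT.
Qed.

(** Growing a tree inside [T.2] until it covers all vertices of [T.1] uses one edge fewer than there
    are vertices. *)
Lemma connected_subgraph_card T : connected_subgraph T -> #|T.1| <= #|T.2|.+1.
Proof.
move=> /connected_subgraph_cut cT; case U1: #|T.1| => [|n] //.
have [|W [F [_ _ sF <- _]]] := partial_tree (n := n) cT; first by rewrite U1.
by rewrite ltnS subset_leq_card.
Qed.

Lemma spanning_tree U : connected_set U -> U != set0 ->
  exists2 T, connected_subgraph T & T.1 = U /\ #|T.2|.+1 = #|U|.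
Proof.
move=> cU; rewrite -card_gt0; case cardU: #|U| => [|n] // _.
have cE : cut_connected (edge_rel (edges X)) U.
  by apply: eq_cut_connected cU => u v; rewrite edge_rel_edges.
have [|W [F [sWU cardW sF cardF [covF cF]]]] := partial_tree (n := n) cE.
  by rewrite cardU.
have WU : W = U by apply/eqP; rewrite eqEcard sWU cardU cardW leqnn.
subst W; exists (U, F); last by rewrite /= cardF.
rewrite /connected_subgraph /is_subgraph /= sF covF /=.
by apply/forall_inP=> x xU; apply/forall_inP=> y yU; apply: cF.
Qed.

Lemma steiner_treeP W T : reflect
  (spans W T /\ forall T', spans W T' -> #|T.2| <= #|T'.2|) (steiner_tree W T).
Proof.
rewrite /steiner_tree /steiner_dist; case: pickP => [T0 spT0|no]; last first.
  by apply: (iffP andP) => [[]|[]]; rewrite [spans W T]no.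
case: arg_minnP => // T1 spT1 minT1.
apply: (iffP andP) => [[spT /eqP[<-]]|[spT minT]]; first by split.
by split=> //; apply/eqP; congr Some; apply/eqP; rewrite eqn_leq minT // minT1.
Qed.

(** Minimizing edges minimizes vertices: a connected subgraph has at least as many edges as its
    vertex number less one, and a spanning tree of a competitor [U'] attains this bound. *)
Lemma steiner_tree_min W T : W != set0 -> steiner_tree W T -> min_connected W T.1.
Proof.
move=> W0 /steiner_treeP[/andP[cT sWT] minT]; split=> //.
  exact: connected_subgraph_set.
move=> U' cU' sWU'.
have [|T' cT' [T'U' <-]] := spanning_tree cU'.
  by apply: contraNneq W0 => U'0; rewrite -subset0 -U'0.
apply: leq_trans (connected_subgraph_card cT) _.
by rewrite ltnS minT // /spans /= cT' T'U'.
Qed.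

Lemma min_steiner_tree W U : W != set0 -> min_connected W U ->
  exists2 T, steiner_tree W T & T.1 = U /\ #|T.2|.+1 = #|U|.
Proof.
move=> W0 [cU sWU minU].
have [|T cT [TU cardT]] := spanning_tree cU.
  by apply: contraNneq W0 => U0; rewrite -subset0 -U0.
exists T => //; apply/steiner_treeP; split=> [|T' /andP[cT' sWT']].
  by rewrite /spans /= cT TU.
rewrite -ltnS cardT (leq_trans _ (connected_subgraph_card cT')) //.
by apply: minU => //; exact: connected_subgraph_set.
Qed.

Lemma min_connected_dist W U :
  W != set0 -> min_connected W U -> steiner_dist W = Some #|U|.-1.
Proof.
move=> W0 /(min_steiner_tree W0)[T /andP[_ /eqP->] [_ <-]].
by [].
Qed.

Lemma min_connected_ex W U : W != set0 -> connected_set U -> W \subset U ->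
  exists Q, min_connected W Q.
Proof.
move=> W0 cU sWU.
have [|T0 cT0 [T0U _]] := spanning_tree cU.
  by apply: contraNneq W0 => U0; rewrite -subset0 -U0.
have spT0 : spans W T0 by rewrite /spans /= cT0 T0U.
case: (arg_minnP (fun T => #|T.2|) spT0) => T spT minT.
by exists T.1; apply: steiner_tree_min => //; apply/steiner_treeP.
Qed.

(** From here on, trees are replaced by vertex sets. Positivity of [k] keeps [B] nonempty; for empty
    [B] a single vertex without edges is also a Steiner tree, although it is not a minimum connected
    set. *)
Lemma steiner_gpP k (A : {set X}) : 0 < k -> reflect
  (forall B U : {set X}, B \subset A -> #|B| = k -> min_connected B U ->
     U :&: A = B)
  (steiner_gp k A).
Proof.
move=> k0; have nz (B : {set X}) : #|B| = k -> B != set0.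
  by move=> Bk; rewrite -card_gt0 Bk.
apply: (iffP forallP) => [gpA B U sBA Bk minU | gpA B].
  have [T stT [<- _]] := min_steiner_tree (nz B Bk) minU.
  have := gpA B; rewrite sBA Bk eqxx => /forallP/(_ T).
  by rewrite stT => /eqP.
apply/implyP=> /andP[sBA /eqP Bk]; apply/forallP=> T; apply/implyP=> stT.
by apply/eqP/gpA => //; apply: steiner_tree_min (nz B Bk) stT.
Qed.

Lemma connected_setT : connected X -> connected_set [set: X].
Proof.
move/forallP=> cX; apply: connect_cut_connected => [a b|x y _ _].
  by rewrite !inE.
by move/forallP: (cX x).
Qed.

Lemma min_connected_self B U :
  connected_set B -> min_connected B U -> U = B.
Proof.
by move=> cB [_ sBU minU]; apply/esym/eqP; rewrite eqEcard sBU minU.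
Qed.

Lemma sgp_sup k (A : {set X}) : steiner_gp k A -> #|A| <= sgp X k.
Proof. by move=> gpA; rewrite /sgp (bigmax_sup A). Qed.

End VertexSets.

(** * Embeddings and induced subgraphs *)

Lemma connected_set_imset (X Y : sgraph) (f : X -> Y) (U : {set X}) :
  injective f -> (forall x y, adj (f x) (f y) = adj x y) ->
  connected_set (f @: U) <-> connected_set U.
Proof.
move=> injf adjf; split=> cU W x y.
  move=> xU yU xW yW.
  have [||||a [b [/imsetP[a' a'U ->] /imsetP[b' b'U ->]]]] :=
    cU (f @: W) (f x) (f y); rewrite ?mem_imset // adjf => aW bW ab.
  by exists a', b'.
move=> /imsetP[x' x'U ->] /imsetP[y' y'U ->] xW yW.
have [||a [b [aU bU aW bW ab]]] := cU (f @^-1: W) x' y' x'U y'U; rewrite ?inE //.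
by rewrite !inE in aW bW; exists (f a), (f b); rewrite adjf !mem_imset.
Qed.

Lemma connected_induced_set (X : sgraph) (B : {set X}) :
  connected (induced B) -> connected_set B.
Proof.
move/connected_setT=> cT.
have -> : B = [set val u | u in [set: induced B]].
  apply/setP=> x; apply/idP/imsetP => [xB|[u _ ->]]; last exact: valP u.
  by exists (Sub x xB).
by apply/(@connected_set_imset (induced B) X val) => //; apply: val_inj.
Qed.

(** Since [B] is disconnected, every connected superset of it is strictly larger, so [w |: B] is a
    minimum one; its spanning tree has [#|B|] edges. The sets are moved to the induced subgraph by
    [pre]. *)
Lemma steiner_dist_induced (X : sgraph) (B C : {set X}) w :
  B \subset C -> w \in C -> w \notin B -> B != set0 ->
  connected_set (w |: B) -> ~ connected_set B ->
  @steiner_dist (induced C) [set u | val u \in B] = Some #|B|.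
Proof.
move=> sBC wC wB B0 cwB ncB.
pose pre (D : {set X}) : {set induced C} := [set u | val u \in D].
have im_pre (D : {set X}) : D \subset C -> [set val u | u in pre D] = D.
  move=> sDC; apply/setP=> x; apply/imsetP/idP => [[u]|xD].
    by rewrite inE => uD ->.
  by exists (Sub x (subsetP sDC x xD)); rewrite ?inE.
have card_pre (D : {set X}) : D \subset C -> #|pre D| = #|D|.
  by move=> sDC; rewrite -{2}(im_pre D sDC) card_imset //; apply: val_inj.
have conn (U : {set induced C}) :
  connected_set [set val u | u in U] <-> connected_set U.
  exact: (@connected_set_imset (induced C) X val U val_inj).
have swC : w |: B \subset C by rewrite subUset sub1set wC.
rewrite -/(pre B) (@min_connected_dist _ _ (pre (w |: B))).
- by rewrite card_pre // cardsU1 wB.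
- by rewrite -card_gt0 card_pre // card_gt0.
split.
- by apply/conn; rewrite im_pre.
- by apply/subsetP=> u; rewrite !inE => ->; rewrite orbT.
move=> U' cU' sU'; rewrite card_pre // cardsU1 wB add1n -(card_pre B) //.
rewrite proper_card // properEneq sU' andbT; apply/eqP=> eqU'.
by apply: ncB; rewrite -(im_pre B) //; apply/conn; rewrite eqU'.
Qed.

(** A connector [w] of [C] outside [B] would put [B] at Steiner distance exactly [k] in the subgraph
    induced on [C]. *)
Lemma join_critical_closed (X : sgraph) k (B C : {set X}) w :
  join_critical k C -> B \subset C -> #|B| = k -> 0 < k ->
  w \in C -> connected_set (w |: B) -> ~ connected_set B -> w \in B.
Proof.
move=> /andP[_ /forallP/(_ B)] jcC sBC Bk k0 wC cwB ncB.
apply/negPn/negP=> wB; move: jcC; rewrite sBC Bk eqxx /=.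
by rewrite (steiner_dist_induced sBC wC wB) ?Bk ?eqxx // -card_gt0 Bk.
Qed.

Lemma adj_neighbour (X : sgraph) (U : {set X}) x :
  connected_set U -> 1 < #|U| -> x \in U -> exists2 y, y \in U & adj x y.
Proof.
move=> cU U1 xU.
have /subsetPn[y yU yx] : ~~ (U \subset [set x]).
  by apply/negP=> /subset_leq_card; rewrite cards1 leqNgt U1.
have [a [b [_ bU /set1P-> _ xb]]] := cU [set x] x y xU yU (set11 x) yx.
by exists b.
Qed.

(** * Connected sets in the lexicographic product *)

Section Lex.
Variables G H : sgraph.
Implicit Types (B U : {set lex G H}) (P Q S : {set G}).

Definition proj B : {set G} := [set x.1 | x in B].

Lemma mem_proj B (x : lex G H) : x \in B -> x.1 \in proj B.
Proof. exact: imset_f. Qed.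

Lemma connected_proj U : connected_set U -> connected_set (proj U).
Proof.
move=> cU W _ _ /imsetP[x xU ->] /imsetP[y yU ->] xW yW.
have [||a [b [aU bU]]] := cU [set z | z.1 \in W] x y xU yU; rewrite ?inE //.
move=> aW bW; case/orP=> [ab|/andP[/eqP ab _]]; last by rewrite -ab aW in bW.
by exists a.1, b.1; rewrite !mem_proj.
Qed.

(** If a cut splits a layer, a vertex of [U] over a neighbouring vertex of [G] is adjacent to both
    sides, so one of these edges crosses. Otherwise the cut projects to a cut of [proj U], and a
    crossing edge there lifts. *)
Lemma connected_lift U :
  1 < #|proj U| -> connected_set (proj U) -> connected_set U.
Proof.
move=> U1 cU W x y xU yU xW yW.
have layer a b : a \in U -> b \in U -> a \in W -> b \notin W -> a.1 = b.1 ->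
    exists a b, [/\ a \in U, b \in U, a \in W, b \notin W & adj a b].
  move=> aU bU aW bW ab.
  have [_ /imsetP[c cU' ->] ac] := adj_neighbour cU U1 (mem_proj aU).
  have [cW|cW] := boolP (c \in W).
    by exists c, b; split=> //; apply/orP; left; rewrite adj_sym -ab.
  by exists a, c; split=> //; apply/orP; left.
have [yWU|yWU] := boolP (y.1 \in proj (W :&: U)).
  by case/imsetP: yWU => z /setIP[zW zU] yz; apply: (layer z y).
have [||||a [b [_ /imsetP[b' b'U ->] /imsetP[a' /setIP[a'W a'U] ->] bWU ab]]] :=
    cU (proj (W :&: U)) x.1 y.1; rewrite ?yWU //; try exact: mem_proj.
  by apply: mem_proj; rewrite inE xW.
exists a', b'; split=> //; last by apply/orP; left.
by apply: contra bWU => b'W; rewrite mem_proj // inE b'W.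
Qed.

(** The competitor that bounds the size of a minimum connected set from above: [B] with one vertex,
    at height [h0], over each vertex of [Q] that [B] misses. *)
Definition layer_fill B Q h0 : {set lex G H} :=
  B :|: [set (g, h0) | g in Q :\: proj B].

Lemma proj_layer_fill B Q h0 :
  proj B \subset Q -> proj (layer_fill B Q h0) = Q.
Proof.
move=> sBQ; apply/setP=> g; apply/imsetP/idP => [[x xB ->]|gQ].
  case/setUP: xB => [xB|/imsetP[g' /setDP[g'Q _] ->] //].
  exact: (subsetP sBQ) (mem_proj xB).
have [/imsetP[x xB ->]|gB] := boolP (g \in proj B).
  by exists x; rewrite // inE xB.
exists (g, h0) => //; rewrite inE; apply/orP; right.
by apply/imsetP; exists g; rewrite // inE gB.
Qed.

Lemma card_layer_fill B Q h0 : #|layer_fill B Q h0| <= #|B| + #|Q :\: proj B|.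
Proof.
apply: leq_trans (leq_card_setU _ _) _.
by rewrite leq_add2l leq_imset_card.
Qed.

(** [U] splits into [B], the other vertices in layers that meet [B], and the layers that miss [B];
    each of the last contributes at least one vertex. *)
Lemma card_over B U : B \subset U ->
  #|B| + #|[set x in U | x.1 \in proj B] :\: B| + #|proj U :\: proj B| <= #|U|.
Proof.
move=> sBU; set L := [set x in U | x.1 \in proj B].
have sBL : B \subset L.
  by apply/subsetP=> x xB; rewrite inE (subsetP sBU) // mem_proj.
have -> : #|B| + #|L :\: B| = #|L| by rewrite -[RHS](cardsID B) (setIidPr sBL).
have sLU : L \subset U by apply/subsetP=> x; rewrite inE => /andP[].
rewrite -[leqRHS](cardsID L) (setIidPr sLU) leq_add2l.
apply: leq_trans (leq_imset_card (fun x : lex G H => x.1) _).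
apply/subset_leq_card/subsetP=> _ /setDP[/imsetP[x xU ->] xB].
by apply: mem_proj; rewrite !inE xU andbT /= xB.
Qed.

Lemma min_connected_lex B U S (h0 : H) :
  connected G -> 1 < #|proj B| -> min_connected B U ->
  (forall Q, min_connected (proj B) Q -> Q :&: S = proj B) ->
  forall x, x \in U -> x.1 \in S -> x \in B.
Proof.
move=> cG B1 [cU sBU minU] gpS x xU xS.
have sproj : proj B \subset proj U by apply: imsetS.
have [|||Q [cQ sBQ minQ]] := @min_connected_ex G (proj B) [set: G].
- by rewrite -card_gt0 ltnW.
- exact: connected_setT.
- exact: subsetT.
have Q1 : 1 < #|Q| := leq_trans B1 (subset_leq_card sBQ).
have leU : #|U| <= #|B| + #|Q :\: proj B|.
  apply: leq_trans (card_layer_fill B Q h0); apply: minU; last exact: subsetUl.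
  by apply: connected_lift; rewrite proj_layer_fill.
have leQ : #|Q| <= #|proj U| by apply: minQ => //; apply: connected_proj.
have := card_over sBU.
set e := #|_ :\: B| => geU.
have cQD := cardsD Q (proj B); rewrite (setIidPr sBQ) in cQD.
have cUD := cardsD (proj U) (proj B); rewrite (setIidPr sproj) in cUD.
have leD : #|Q :\: proj B| <= #|proj U :\: proj B|.
  by rewrite cQD cUD leq_sub2r.
have le1 := leq_trans geU leU; rewrite -addnA leq_add2l in le1.
have e0 : e = 0.
  apply/eqP; rewrite -leqn0 -(leq_add2r #|Q :\: proj B|) add0n.
  by apply: leq_trans le1; rewrite leq_add2l.
have leDQ : #|proj U :\: proj B| <= #|Q :\: proj B| by rewrite e0 in le1.
have leUQ : #|proj U| <= #|Q|.
  by move: leDQ; rewrite cUD cQD leq_subLR subnKC // subset_leq_card.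
(* The same squeeze gives [proj U] the size of [Q], so the hypothesis on minimum sets applies to
   [proj U] itself. *)
have minpU : min_connected (proj B) (proj U).
  split=> // [|U' cU' sU']; first exact: connected_proj.
  exact: leq_trans leUQ (minQ _ cU' sU').
have xpB : x.1 \in proj B by rewrite -(gpS _ minpU) inE mem_proj.
apply/negPn/negP=> xB; move/eqP: e0; rewrite cards_eq0 => /eqP/setP/(_ x).
by rewrite !inE xB xU xpB.
Qed.

Lemma connected_layer g (D : {set H}) :
  @connected_set (lex G H) [set (g, h) | h in D] <-> connected_set D.
Proof.
apply: (@connected_set_imset H (lex G H)) => [h h' []//|h h'].
by rewrite /= /lex_adj /= adj_irr eqxx.
Qed.

Lemma eq_layer B g : proj B \subset [set g] ->
  exists2 D : {set H}, B = [set (g, h) | h in D] & #|D| = #|B|.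
Proof.
move=> /subsetP sBg; pose D := [set h | (g, h) \in B].
have BE : B = [set (g, h) | h in D].
  apply/setP=> -[g' h]; apply/idP/imsetP => [xB|[h']].
    have /set1P/= gg' := sBg _ (mem_proj xB).
    by rewrite gg' in xB *; exists h; rewrite ?inE.
  by rewrite inE => h'B ->.
exists D => //; rewrite [in RHS]BE card_imset // => h h' [].
by [].
Qed.

(** The projection is the edge between [g] and [g'], so [connected_lift] applies. *)
Lemma layer_cone_connected g g' h0 (D : {set H}) : D != set0 -> adj g g' ->
  @connected_set (lex G H) ((g', h0) |: [set (g, h) | h in D]).
Proof.
move=> /set0Pn[d dD] gg'.
have pE : proj ((g', h0) |: [set (g, h) | h in D]) = [set g; g'].
  apply/setP=> a; apply/imsetP/set2P => [[x /setU1P[->|/imsetP[h hD ->]] ->]|].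
  - by right.
  - by left.
  case=> ->; [exists (g, d) | exists (g', h0)] => //; last exact: setU11.
  by apply/setU1r/imset_f.
have gNg' : g != g' by apply: contraTneq gg' => ->; rewrite adj_irr.
apply: connected_lift; rewrite pE; first by rewrite cards2 gNg'.
have edge a b : a \in [set g; g'] -> b \in [set g; g'] -> a != b -> adj a b.
  by case/set2P=> -> /set2P[]->; rewrite ?eqxx // adj_sym.
move=> W x y xg yg xW yW; exists x, y; split=> //; apply: edge => //.
by apply: contraNneq yW => <-.
Qed.

(* Any vertex of a neighbouring layer connects a subset of a layer, so one extra
   vertex suffices. *)
Lemma min_connected_layer g g' (D : {set H}) U :
  D != set0 -> adj g g' -> ~ connected_set D ->
  @min_connected (lex G H) [set (g, h) | h in D] U ->
  exists2 w, w \notin [set (g, h) | h in D] & U = w |: [set (g, h) | h in D].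
Proof.
move=> D0 gg' ncD [cU sDU minU].
have : ~~ (U \subset [set (g, h) | h in D]).
  apply/negP=> sUD; apply: ncD; apply/(connected_layer g).
  by suff <- : U = [set (g, h) | h in D] by []; apply/eqP; rewrite eqEsubset sUD.
case/subsetPn=> w wU wD; exists w => //; apply/esym/eqP.
rewrite eqEcard subUset sub1set wU sDU cardsU1 wD /=.
have /minU/(_ (subsetUr _ _)) := layer_cone_connected (h0 := w.2) D0 gg'.
by move=> leU; apply: leq_trans leU _; rewrite cardsU1 leq_add2r leq_b1.
Qed.

End Lex.

(** * Isolated vertices and attained maxima *)

Lemma isosetP (X : sgraph) (S : {set X}) x y :
  x \in isoset S -> y \in S -> ~~ adj x y.
Proof.
case/imsetP=> u; rewrite inE => /forallP isou -> yS.
exact: isou (Sub y yS).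
Qed.

Lemma isoset_sub (X : sgraph) (S : {set X}) : isoset S \subset S.
Proof. by apply/subsetP=> _ /imsetP[u _ ->]; exact: valP u. Qed.

(** The alternative [A = set0] covers an empty family, whose maximum is 0 by default. *)
Lemma bigmax_card_ex (T : finType) (p : pred {set T}) :
  exists2 A : {set T}, #|A| = \max_(A : {set T} | p A) #|A| & p A \/ A = set0.
Proof.
have [A pA|no] := pickP p; last first.
  by exists set0; [rewrite cards0 big_pred0 | right].
have [|A0 pA0 ->] := @eq_bigmax_cond _ p (fun A : {set T} => #|A|).
  by apply/card_gt0P; exists A.
by exists A0 => //; left.
Qed.

(** * The two lower bounds and the equality *)

Section Bounds.
Variables (G H : sgraph) (k : nat).
Hypotheses (G_nontrivial : 1 < #|G|) (H_nontrivial : 1 < #|H|).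
Hypotheses (G_connected : connected G) (k_gt1 : 1 < k).

Let h0 : H := enum_val (Ordinal (ltnW H_nontrivial)).

Lemma steiner_gp_itvP a b (S : {set G}) t :
  steiner_gp_itv a b S -> a <= t <= b -> steiner_gp t S.
Proof.
move=> /forallP gpS /andP[at_ tb]; rewrite -ltnS in tb.
by have := gpS (Ordinal tb); rewrite at_.
Qed.

Definition layers (S : {set G}) (C : G -> {set H}) : {set lex G H} :=
  [set x | (x.1 \in S) && (x.2 \in C x.1)].

Lemma card_layers S C : #|layers S C| = \sum_(g in S) #|C g|.
Proof.
rewrite -sum1_card (eq_bigl (fun x : G * H => (x.1 \in S) && (x.2 \in C x.1))).
  rewrite -(pair_big_dep (mem S) (fun g h => h \in C g) (fun _ _ => 1)) /=.
  by apply: eq_bigr => g _; rewrite sum1_card.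
by move=> x; rewrite inE.
Qed.

Lemma proj_layers_sub S C (B : {set lex G H}) :
  B \subset layers S C -> proj B \subset S.
Proof.
move/subsetP=> sB; apply/subsetP=> _ /imsetP[x /sB xL ->].
by rewrite inE in xL; case/andP: xL.
Qed.

(** When [B] meets at least two layers, the Steiner general position of [S] decides the matter,
    whatever the fibres [C] are. *)
Lemma layers_gp S C a b (B U : {set lex G H}) :
  steiner_gp_itv a b S -> B \subset layers S C -> a <= #|proj B| <= b ->
  1 < #|proj B| -> min_connected B U -> U :&: layers S C = B.
Proof.
move=> gpS sB tab B1 minU; have [_ sBU _] := minU.
have gpt := steiner_gp_itvP gpS tab.
apply/eqP; rewrite eqEsubset subsetI sBU sB !andbT.
apply/subsetP=> x /setIP[xU]; rewrite inE => /andP[xS _].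
apply: (min_connected_lex h0 G_connected B1 minU) xU xS => Q.
by move/(steiner_gpP _ (ltnW B1)): gpt; apply=> //; apply: proj_layers_sub sB.
Qed.

(** The witness has a largest join-critical set as fibre over isolated vertices of [S] and a largest
    Steiner clique over the others. The fibres only matter when [B] lies in one layer. *)
Lemma sgp_lex_small (S : {set G}) : steiner_gp_itv 2 k S ->
  #|isoset S| * sjc H k + #|nonisoset S| * somega H k <= sgp (lex G H) k.
Proof.
move=> gpS; have k0 := ltnW k_gt1.
have [J cardJ jcJ] := bigmax_card_ex (@join_critical H k).
have [Om cardOm clOm] := bigmax_card_ex (@steiner_clique H k).
pose C g := if g \in isoset S then J else Om.
have -> : #|isoset S| * sjc H k + #|nonisoset S| * somega H k = #|layers S C|.
  rewrite card_layers (big_setID (isoset S)) /= (setIidPr (isoset_sub S)).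
  rewrite -!sum_nat_const; congr (_ + _); apply: eq_bigr => g.
    by rewrite /C => ->.
  by rewrite /C inE => /andP[/negPf->].
apply: sgp_sup; apply/steiner_gpP => // B U sBA Bk minU.
have pk : #|proj B| <= k by rewrite -Bk; apply: leq_imset_card.
have [p1|] := ltnP 1 #|proj B|.
  by apply: (layers_gp gpS sBA _ p1 minU); rewrite p1.
have [b bB] : exists b, b \in B by apply/card_gt0P; rewrite Bk.
pose g := b.1; move=> p1.
have pg : proj B \subset [set g].
  suff /eqP<- : [set g] == proj B by [].
  by rewrite eqEcard sub1set mem_proj // cards1.
have [D BE cardD] := eq_layer pg; rewrite Bk in cardD.
have D0 : D != set0 by rewrite -card_gt0 cardD.
have sDC : D \subset C g.
  apply/subsetP=> h hD; have : (g, h) \in B by rewrite BE imset_f.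
  by move/(subsetP sBA); rewrite inE => /andP[].
have gS : g \in S by have := subsetP sBA _ bB; rewrite inE => /andP[].
have [_ sBU _] := minU.
(* A fibre containing the nonempty [D] is not the default empty set, so it has the property it was
   chosen for. *)
have nonempty (F : {set H}) (p : pred {set H}) : D \subset F -> p F \/ F = set0 -> p F.
  by move=> sDF [] // F0; rewrite F0 subset0 (negPf D0) in sDF.
rewrite /C in sDC; case: ifP sDC => [gI|gI] sD; last first.
  (* In a Steiner clique the [k]-set [D] is connected, so [B] is its own minimum connected set. *)
  have /forallP/(_ D) := nonempty Om _ sD clOm; rewrite sD cardD eqxx /=.
  move/connected_induced_set/(connected_layer g); rewrite -BE => cB.
  by rewrite (min_connected_self cB minU); apply/setIidPl.
have jc := nonempty J _ sD jcJ.
have [g' _ gg'] : exists2 g', g' \in [set: G] & adj g g'.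
  by apply: adj_neighbour; rewrite ?cardsT ?inE //; apply: connected_setT.
apply/eqP; rewrite eqEsubset subsetI sBU sBA !andbT.
apply/subsetP=> x /setIP[xU xA]; apply/negPn/negP=> xB.
have ncD : ~ connected_set D.
  move/(connected_layer g); rewrite -BE => cB.
  by rewrite (min_connected_self cB minU) (negPf xB) in xU.
rewrite BE in minU xB.
have [w wD UE] := min_connected_layer D0 gg' ncD minU.
have xw : x = w.
  by move: xU; rewrite UE => /setU1P[] // xD; rewrite xD in xB.
subst w; have [cU _ _] := minU.
have U1 : 1 < #|U|.
  by rewrite UE cardsU1 wD card_imset ?cardD // => h h' [].
(* The extra vertex [x] has a neighbour in [U], necessarily in the layer of [g]. An edge coming from
   [G] contradicts that [g] is isolated in [S]; otherwise [x] lies over [g] and join-criticality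
   puts it into [B]. *)
have [y] := adj_neighbour cU U1 xU.
rewrite {1}UE => /setU1P[->|/imsetP[h hD ->]]; first by rewrite adj_irr.
move: xA; rewrite inE => /andP[xS xC].
case/orP=> /= [xg|/andP[/eqP xg _]].
  by have := isosetP gI xS; rewrite adj_sym xg.
have xE : x = (g, x.2) by rewrite -xg -surjective_pairing.
rewrite xE in xB UE; rewrite /C xg gI in xC.
have UE' : U = [set (g, h) | h in x.2 |: D] by rewrite imsetU1.
rewrite UE' in cU; move/(connected_layer g): cU => cD.
by have xD := join_critical_closed jc sD cardD k0 xC cD ncD; rewrite imset_f in xB.
Qed.

(** With full fibres, a [k]-set needs at least [ceil_div k #|H|] layers, hence more than one because
    [#|H| < k]; the one-layer case never occurs. *)
Lemma sgp_lex_large : #|H| < k ->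
  sgp_itv G (ceil_div k #|H|) (minn k #|G|) * #|H| <= sgp (lex G H) k.
Proof.
move=> Hk; have H0 := ltnW H_nontrivial; rewrite /sgp_itv.
have [S <- gpS] := bigmax_card_ex (@steiner_gp_itv G (ceil_div k #|H|) (minn k #|G|)).
case: gpS => [gpS|->]; last by rewrite cards0.
have -> : #|S| * #|H| = #|layers S (fun=> [set: H])|.
  by rewrite card_layers cardsT sum_nat_const.
apply: sgp_sup; apply/steiner_gpP => [|B U sBA Bk minU]; first exact: ltnW.
have le_k : k <= #|proj B| * #|H|.
  rewrite -Bk -[#|H|]cardsT -sum_nat_const -card_layers subset_leq_card //.
  by apply/subsetP=> x xB; rewrite !inE mem_proj.
have p1 : 1 < #|proj B|.
  by rewrite -(ltn_pmul2r H0) mul1n (leq_trans Hk).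
apply: (layers_gp gpS sBA _ p1 minU).
rewrite leq_min -{2}Bk leq_imset_card max_card !andbT /ceil_div.
have [dv|ndv] := boolP (#|H| %| k); first by rewrite addn0 leq_divLR.
rewrite addn1 ltn_divLR // ltn_neqAle le_k andbT.
by apply: contraNneq ndv => ->; rewrite dvdn_mull.
Qed.

Lemma sgp_lex_top : (#|G| - 1) * #|H| < k < #|G| * #|H| ->
  sgp (lex G H) k = sgp_itv G (ceil_div k #|H|) (minn k #|G|) * #|H|.
Proof.
case/andP=> gtk ltk; have H0 := ltnW H_nontrivial.
have Hk : #|H| < k by apply: leq_ltn_trans gtk; rewrite leq_pmull // subn_gt0.
apply/eqP; rewrite eqn_leq sgp_lex_large // andbT.
(* The whole product bounds the left side, so it suffices that all of [G] is admissible on the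
   right. *)
apply: (@leq_trans (#|G| * #|H|)).
  by apply/bigmax_leqP=> A _; rewrite -card_prod max_card.
rewrite leq_mul2r; apply/orP; right.
rewrite /sgp_itv (bigmax_sup [set: G]) ?cardsT //.
have Gj : #|G| <= ceil_div k #|H|.
  have := leq_div2r #|H| (ltnW gtk); rewrite mulnK // /ceil_div => le1.
  have [/dvdnP[q kq]|ndv] := boolP (#|H| %| k).
    move: gtk; rewrite kq ltn_pmul2r // mulnK // addn0 -ltnS subn1 prednK //.
    exact: ltnW.
  by rewrite -(subnK (ltnW G_nontrivial)) leq_add2r.
(* Every [t] in the range is at least [#|G|], so a [t]-subset can only be the full vertex set, and
   its trees span. *)
apply/forallP=> t; apply/implyP=> jt; have Gt := leq_trans Gj jt.
apply/forallP=> B; apply/implyP=> /andP[_ /eqP Bt].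
have -> : B = [set: G] by apply/eqP; rewrite eqEcard subsetT cardsT Bt.
apply/forallP=> T; apply/implyP=> /andP[/andP[_]].
by rewrite subTset setIT.
Qed.

End Bounds.

Theorem theorem5p2 (G H : sgraph) (k : nat)
    (G_nontrivial : 2 <= #|G|) (H_nontrivial : 2 <= #|H|)
    (G_connected : connected G)
    (k_range : 2 <= k <= #|G| * #|H| - 1) :
  let j := ceil_div k #|H| in
  let l := minn k #|G| in
  [/\ k <= #|H| ->
        sgp (lex G H) k >=
          \max_(S : {set G} | steiner_gp_itv 2 k S)
             (#|isoset S| * sjc H k + #|nonisoset S| * somega H k),
      #|H| < k < #|G| * #|H| ->
        sgp (lex G H) k >= sgp_itv G j l * #|H|
    & (#|G| - 1) * #|H| < k ->
        sgp (lex G H) k = sgp_itv G j l * #|H| ].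
Proof.
move=> j l; case/andP: k_range => k1; rewrite subn1 => lek.
have ltk : k < #|G| * #|H|.
  have GH0 : 0 < #|G| * #|H| by rewrite muln_gt0 (ltnW G_nontrivial) ltnW.
  by rewrite -(prednK GH0) ltnS.
split=> [_|/andP[Hk _]|gtk].
- by apply/bigmax_leqP=> S gpS; apply: sgp_lex_small.
- exact: sgp_lex_large.
- by apply: sgp_lex_top; rewrite ?gtk.
Qed.
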